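(* Let $P$ be an arbitrary set, let $\mathcal{MS}^{co}$ be the category of the monoidal comonad freely generated by $P$ as set of generating objects, and let $\mathit{Rel}$ be the category of all binary relations between finite ordinals. Then the functor $G:\mathcal{MS}^{co}\to\mathit{Rel}$ defined in the context is faithful; i.e. for all objects $A,B$ and all arrows $f,g:A\to B$ of $\mathcal{MS}^{co}$, if $Gf=Gg$, then $f=g$.
   Context: A monoidal category has a bifunctor $\otimes$, a unit object $I$ and natural isomorphisms $a_{A,B,C}:(A\otimes B)\otimes C\to A\otimes(B\otimes C)$, $l_A:I\otimes A\to A$, $r_A:A\otimes I\to A$ satisfying the usual coherence conditions. $\mathbf 1_A$ denotes the identity arrow of $A$. A monoidal comonad in a monoidal category is a comonad $\langle L,\varepsilon,\delta\rangle$ (with $\varepsilon_A:LA\to A$, $\delta_A:LA\to LLA$) together with a natural transformation with components $\psi_{A,B}:LA\otimes LB\to L(A\otimes B)$ and an arrow $\psi_0:I\to LI$ such that - $La_{A,B,C}\circ\psi_{A\otimes B,C}\circ(\psi_{A,B}\otimes\mathbf 1_{LC})=\psi_{A,B\otimes C}\circ(\mathbf 1_{LA}\otimes\psi_{B,C})\circ a_{LA,LB,LC}$, - $Ll_A\circ\psi_{I,A}\circ(\psi_0\otimes\mathbf 1_{LA})=l_{LA}$ and $Lr_A\circ\psi_{A,I}\circ(\mathbf 1_{LA}\otimes\psi_0)=r_{LA}$, - $\varepsilon_{A\otimes B}\circ\psi_{A,B}=\varepsilon_A\otimes\varepsilon_B$, - $\delta_{A\otimes B}\circ\psi_{A,B}=L\psi_{A,B}\circ\psi_{LA,LB}\circ(\delta_A\otimes\delta_B)$,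 - $\varepsilon_I\circ\psi_0=\mathbf 1_I$ and $\delta_I\circ\psi_0=L\psi_0\circ\psi_0$. $\mathcal{MS}^{co}$ is the free such structure on $P$: its objects are the formal expressions built from elements of $P$ and $I$ by $\otimes$ and $L$; its arrows are arrow terms built from identities, $a,a^{-1},l,l^{-1},r,r^{-1},\varepsilon,\delta,\psi,\psi_0$ by $\circ$, $\otimes$ and $L$, modulo the congruence generated by the equations of categories, functoriality, naturality, monoidal categories, comonads, and the equations above. $\mathit{Rel}$ has as objects the finite ordinals $n=\{0,\dots,n-1\}$ and as arrows $n\to m$ all relations $R\subseteq n\times m$, with the usual composition of relations. The functor $G$: $GA$ is the number of occurrences of $L$ in $A$; the elements $0,\dots,GA-1$ of $GA$ correspond to the occurrences of $L$ in $A$ counted from right to left. On arrow terms: $G$ of an identity and of $a_{A,B,C}$, $l_A$, $r_A$ and their inverses is the identity relation; $G\psi_{A,B}$ relates both the occurrence of $L$ in front of $A$ and the occurrence of $L$ in front of $B$ in the source $LA\otimes LB$ to the outermost occurrence of $L$ in the target $L(A\otimes B)$, and relates every occurrence of $L$ inside $A$, respectively inside $B$, to the corresponding occurrence inside $A$, respectively $B$ (and nothing else is related); $G\psi_0$ is the empty relation from $0=\emptyset$ to $1=\{\emptyset\}$; $G\varepsilon_A\subseteq(GA+1)\times GA$ is $\{(i,i)\mid i<GA\}$; $G\delta_A\subseteq(GA+1)\times(GA+2)$ is $\{(i,i)\mid i\le GA\}\cup\{(GA,GA+1)\}$; $G(f\otimes g)$ is the juxtaposition of $Gf$ (on the left,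 i.e. on the larger elements) and $Gg$ (on the right, i.e. on the smaller elements); $GLf$ extends $Gf$ by relating the new leftmost (greatest) element of the source to the new leftmost (greatest) element of the target; $G(g\circ f)=Gg\circ Gf$. *)

(* Defs.v *)
From mathcomp Require Import all_boot.
From mathcomp Require Import zify.

Set Implicit Arguments.
Unset Strict Implicit.
Unset Printing Implicit Defensive.

(* Categories whose hom-sets carry an explicit equality [eqhom]; in a category
   of arrow terms modulo equations, [eqhom] is the congruence they generate.  *)
Record category := Category {
  obj :> Type;
  hom : obj -> obj -> Type;
  eqhom : forall A B, hom A B -> hom A B -> Prop;
  idc : forall A, hom A A;
  compc : forall A B C, hom B C -> hom A B -> hom A C;
  eqhom_refl : forall A B (f : hom A B), eqhom f f;
  eqhom_sym : forall A B (f g : hom A B), eqhom f g -> eqhom g f;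
  eqhom_trans : forall A B (f g h : hom A B),
    eqhom f g -> eqhom g h -> eqhom f h;
  compc_congr : forall A B C (g g' : hom B C) (f f' : hom A B),
    eqhom g g' -> eqhom f f' -> eqhom (compc g f) (compc g' f');
  compc_idl : forall A B (f : hom A B), eqhom (compc (idc B) f) f;
  compc_idr : forall A B (f : hom A B), eqhom (compc f (idc A)) f;
  compc_assoc : forall A B C D (h : hom C D) (g : hom B C) (f : hom A B),
    eqhom (compc (compc h g) f) (compc h (compc g f))
}.

Record functor (C D : category) := Functor {
  fobj :> C -> D;
  fhom : forall A B : C, hom A B -> hom (fobj A) (fobj B);
  fhom_congr : forall (A B : C) (f g : hom A B),
    eqhom f g -> eqhom (fhom f) (fhom g);
  fhom_id : forall A : C, eqhom (fhom (idc A)) (idc (fobj A));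
  fhom_comp : forall (A B E : C) (g : hom B E) (f : hom A B),
    eqhom (fhom (compc g f)) (compc (fhom g) (fhom f))
}.

Definition faithful (C D : category) (F : functor C D) : Prop :=
  forall (A B : C) (f g : hom A B), eqhom (fhom F f) (fhom F g) -> eqhom f g.

Inductive ob (P : Type) : Type :=
| Gen of P
| I
| Ten of ob P & ob P
| L of ob P.
Arguments I {P}.

Declare Scope ob_scope.
Delimit Scope ob_scope with ob.
Bind Scope ob_scope with ob.
Notation "A ⊗ B" := (Ten A B) (at level 40, left associativity) : ob_scope.

Inductive arr (P : Type) : ob P -> ob P -> Type :=
| Id A : arr A A
| Comp A B C : arr B C -> arr A B -> arr A C
| TenA A A' B B' : arr A A' -> arr B B' -> arr (A ⊗ B) (A' ⊗ B')
| LA A B : arr A B -> arr (L A) (L B)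
| assoc A B C : arr ((A ⊗ B) ⊗ C) (A ⊗ (B ⊗ C))
| assocV A B C : arr (A ⊗ (B ⊗ C)) ((A ⊗ B) ⊗ C)
| lunit A : arr (I ⊗ A) A
| lunitV A : arr A (I ⊗ A)
| runit A : arr (A ⊗ I) A
| runitV A : arr A (A ⊗ I)
| eps A : arr (L A) A
| delta A : arr (L A) (L (L A))
| psi A B : arr (L A ⊗ L B) (L (A ⊗ B))
| psi0 : arr I (L I).
Arguments psi0 {P}.

Declare Scope arr_scope.
Delimit Scope arr_scope with arr.
Bind Scope arr_scope with arr.
Notation "g ∘ f" := (Comp g f) (at level 50, left associativity) : arr_scope.
Notation "f ⊗ g" := (TenA f g) (at level 40, left associativity) : arr_scope.
Notation "'𝟏' A" := (Id A) (at level 9, A at level 8) : arr_scope.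

Reserved Notation "f ≈ g" (at level 70, no associativity).

Inductive eqarr (P : Type) : forall A B : ob P, arr A B -> arr A B -> Prop :=
| eqarr_refl A B (f : arr A B) : f ≈ f
| eqarr_sym A B (f g : arr A B) : f ≈ g -> g ≈ f
| eqarr_trans A B (f g h : arr A B) : f ≈ g -> g ≈ h -> f ≈ h
| Comp_congr A B C (g g' : arr B C) (f f' : arr A B) :
    g ≈ g' -> f ≈ f' -> g ∘ f ≈ g' ∘ f'
| TenA_congr A A' B B' (f f' : arr A A') (g g' : arr B B') :
    f ≈ f' -> g ≈ g' -> f ⊗ g ≈ f' ⊗ g'
| LA_congr A B (f f' : arr A B) : f ≈ f' -> LA f ≈ LA f'
| Comp_idl A B (f : arr A B) : 𝟏 B ∘ f ≈ f
| Comp_idr A B (f : arr A B) : f ∘ 𝟏 A ≈ f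
| Comp_assoc A B C D (h : arr C D) (g : arr B C) (f : arr A B) :
    h ∘ g ∘ f ≈ h ∘ (g ∘ f)
| TenA_id A B : 𝟏 A ⊗ 𝟏 B ≈ 𝟏 (A ⊗ B)
| TenA_comp A A' A'' B B' B'' (f : arr A A') (f' : arr A' A'')
    (g : arr B B') (g' : arr B' B'') :
    (f' ∘ f) ⊗ (g' ∘ g) ≈ (f' ⊗ g') ∘ (f ⊗ g)
| LA_id A : LA (𝟏 A) ≈ 𝟏 (L A)
| LA_comp A B C (g : arr B C) (f : arr A B) : LA (g ∘ f) ≈ LA g ∘ LA f
(* Naturality of assocV, lunitV and runitV is derivable.  *)
| assoc_nat A A' B B' C C' (f : arr A A') (g : arr B B') (h : arr C C') :
    assoc A' B' C' ∘ ((f ⊗ g) ⊗ h) ≈ (f ⊗ (g ⊗ h)) ∘ assoc A B C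
| lunit_nat A A' (f : arr A A') : lunit A' ∘ (𝟏 I ⊗ f) ≈ f ∘ lunit A
| runit_nat A A' (f : arr A A') : runit A' ∘ (f ⊗ 𝟏 I) ≈ f ∘ runit A
| eps_nat A A' (f : arr A A') : eps A' ∘ LA f ≈ f ∘ eps A
| delta_nat A A' (f : arr A A') : delta A' ∘ LA f ≈ LA (LA f) ∘ delta A
| psi_nat A A' B B' (f : arr A A') (g : arr B B') :
    psi A' B' ∘ (LA f ⊗ LA g) ≈ LA (f ⊗ g) ∘ psi A B
| assocK A B C : assocV A B C ∘ assoc A B C ≈ 𝟏 ((A ⊗ B) ⊗ C)
| assocVK A B C : assoc A B C ∘ assocV A B C ≈ 𝟏 (A ⊗ (B ⊗ C))
| lunitK A : lunitV A ∘ lunit A ≈ 𝟏 (I ⊗ A)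
| lunitVK A : lunit A ∘ lunitV A ≈ 𝟏 A
| runitK A : runitV A ∘ runit A ≈ 𝟏 (A ⊗ I)
| runitVK A : runit A ∘ runitV A ≈ 𝟏 A
| pentagon A B C D :
    assoc A B (C ⊗ D) ∘ assoc (A ⊗ B) C D
    ≈ (𝟏 A ⊗ assoc B C D) ∘ assoc A (B ⊗ C) D ∘ (assoc A B C ⊗ 𝟏 D)
| triangle A B : (𝟏 A ⊗ lunit B) ∘ assoc A I B ≈ runit A ⊗ 𝟏 B
| eps_delta A : eps (L A) ∘ delta A ≈ 𝟏 (L A)
| Leps_delta A : LA (eps A) ∘ delta A ≈ 𝟏 (L A)
| delta_delta A : delta (L A) ∘ delta A ≈ LA (delta A) ∘ delta A
| psi_assoc A B C :
    LA (assoc A B C) ∘ psi (A ⊗ B) C ∘ (psi A B ⊗ 𝟏 (L C))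
    ≈ psi A (B ⊗ C) ∘ (𝟏 (L A) ⊗ psi B C) ∘ assoc (L A) (L B) (L C)
| psi_lunit A : LA (lunit A) ∘ psi I A ∘ (psi0 ⊗ 𝟏 (L A)) ≈ lunit (L A)
| psi_runit A : LA (runit A) ∘ psi A I ∘ (𝟏 (L A) ⊗ psi0) ≈ runit (L A)
| eps_psi A B : eps (A ⊗ B) ∘ psi A B ≈ eps A ⊗ eps B
| delta_psi A B :
    delta (A ⊗ B) ∘ psi A B
    ≈ LA (psi A B) ∘ psi (L A) (L B) ∘ (delta A ⊗ delta B)
| eps_psi0 : eps I ∘ psi0 ≈ 𝟏 I
| delta_psi0 : delta I ∘ psi0 ≈ LA psi0 ∘ psi0
where "f ≈ g" := (eqarr f%arr g%arr).

Definition MSco (P : Type) : category :=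
  Category (@eqarr_refl P) (@eqarr_sym P) (@eqarr_trans P) (@Comp_congr P)
    (@Comp_idl P) (@Comp_idr P) (@Comp_assoc P).

Definition relation (n m : nat) := {set 'I_n * 'I_m}.

Definition rel_of n m (r : rel nat) : relation n m :=
  [set p | r (val p.1) (val p.2)].

Definition rel_eq n m : relation n m := rel_of n m eq_op.

Definition rel_comp n m p (S : relation m p) (R : relation n m)
    : relation n p :=
  [set x | [exists k, ((x.1, k) \in R) && ((k, x.2) \in S)]].

(* Elements are counted from right to left, so the right-hand factor S comes
   first in the ordinal sums.  *)
Definition rel_juxt n m n' m' (R : relation n m) (S : relation n' m')
    : relation (n' + n) (m' + m) :=
  [set (lshift n p.1, lshift m p.2) | p in S]
  :|: [set (rshift n' p.1, rshift m' p.2) | p in R].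

Definition rel_lift n m (R : relation n m) : relation n.+1 m.+1 :=
  (ord_max, ord_max)
  |: [set (widen_ord (leqnSn n) p.1, widen_ord (leqnSn m) p.2) | p in R].

(* In LA ⊗ LB with b := GB and a := GA, the occurrences of L inside B are
   0, ..., b-1, the L in front of B is b, those inside A are b+1, ..., b+a,
   and the L in front of A is b+1+a; in L(A ⊗ B) those inside B are
   0, ..., b-1, those inside A are b, ..., b+a-1, and the outermost L is
   b+a.  *)
Definition psi_rel (a b : nat) : rel nat := fun i j =>
  [|| (i < b) && (j == i),
      (i == b) && (j == b + a),
      (b < i < b.+1 + a) && (j.+1 == i)
    | (i == b.+1 + a) && (j == b + a)].

Fixpoint Gob (P : Type) (A : ob P) : nat :=
  match A with
  | Gen _ => 0
  | I => 0
  | Ten A B => Gob B + Gob A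
  | L A => (Gob A).+1
  end.

(* The source and target of assoc, lunit and runit have equal, but not
   convertible, values of Gob; rel_eq compares their elements as numbers.  *)
Fixpoint Garr (P : Type) (A B : ob P) (f : arr A B) :
    relation (Gob A) (Gob B) :=
  match f in arr A B return relation (Gob A) (Gob B) with
  | Id A => rel_eq _ _
  | Comp _ _ _ g f => rel_comp (Garr g) (Garr f)
  | TenA _ _ _ _ f g => rel_juxt (Garr f) (Garr g)
  | LA _ _ f => rel_lift (Garr f)
  | assoc _ _ _ => rel_eq _ _
  | assocV _ _ _ => rel_eq _ _
  | lunit _ => rel_eq _ _
  | lunitV _ => rel_eq _ _
  | runit _ => rel_eq _ _
  | runitV _ => rel_eq _ _
  | eps _ => rel_eq _ _
  | delta A => rel_of _ _ (fun i j =>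
      (i == j) || ((i == Gob A) && (j == (Gob A).+1)))
  | psi A B => rel_of _ _ (psi_rel (Gob A) (Gob B))
  | psi0 => set0
  end.

(* R seen as a relation between natural numbers, so that relations between
   equal but non-convertible ordinals can be compared.  *)
Definition nrel n m (R : relation n m) (x y : nat) : Prop :=
  exists i j, [/\ (i, j) \in R, val i = x & val j = y].

Lemma nrelP n m (R S : relation n m) :
  (forall x y, nrel R x y <-> nrel S x y) -> R = S.
Proof.
move=> H; apply/setP => -[i j]; apply/idP/idP => h.
- have /H : nrel R i j by exists i, j.
  by case=> i' [j' [h' /val_inj <- /val_inj <-]].
- have /H : nrel S i j by exists i, j.
  by case=> i' [j' [h' /val_inj <- /val_inj <-]].
Qed.

Lemma nrel_bound n m (R : relation n m) x y : nrel R x y -> x < n /\ y < m.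
Proof. by case=> i [j [_ <- <-]]; split; exact: ltn_ord. Qed.

Lemma nrel_of n m r x y :
  nrel (rel_of n m r) x y <-> x < n /\ y < m /\ r x y.
Proof.
split=> [[i [j [+ <- <-]]]|[hx [hy h]]].
  by rewrite inE /= => h; split.
by exists (Ordinal hx), (Ordinal hy); rewrite inE.
Qed.

Lemma nrel_comp n m p (S : relation m p) (R : relation n m) x y :
  nrel (rel_comp S R) x y <-> exists z, nrel R x z /\ nrel S z y.
Proof.
split=> [[i [j [+ <- <-]]]|[z [[i [k [h <- <-]]] [k' [j [h' /val_inj e <-]]]]]].
  rewrite inE /= => /existsP[k /andP[h h']]; exists k.
  by split; [exists i, k|exists k, j].
exists i, j; split=> //; rewrite inE /=; apply/existsP; exists k.
by rewrite h -e h'.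
Qed.

Lemma nrel_juxt n m n' m' (R : relation n m) (S : relation n' m') x y :
  nrel (rel_juxt R S) x y <->
  nrel S x y \/ n' <= x /\ m' <= y /\ nrel R (x - n') (y - m').
Proof.
split=> [[i [j [+ <- <-]]]|[[i [j [h <- <-]]]|[hx [hy [i [j [h ex ey]]]]]]].
- rewrite inE => /orP[] /imsetP[[k l] h [-> ->]] /=.
    by left; exists k, l.
  by right; rewrite !leq_addr !addKn; do 2 split=> //; exists k, l.
- exists (lshift n i), (lshift m j); split=> //; rewrite inE; apply/orP; left.
  by apply/imsetP; exists (i, j).
- exists (rshift n' i), (rshift m' j); split; last 2 first.
  + by move: ex => /= ->; rewrite subnKC.
  + by move: ey => /= ->; rewrite subnKC.
  rewrite inE; apply/orP; right; by apply/imsetP; exists (i, j).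
Qed.

Lemma nrel_lift n m (R : relation n m) x y :
  nrel (rel_lift R) x y <-> (x = n /\ y = m) \/ nrel R x y.
Proof.
split=> [[i [j [+ <- <-]]]|[[-> ->]|[i [j [h <- <-]]]]].
- rewrite !inE => /orP[/eqP[-> ->]|/imsetP[[k l] h [-> ->]]]; first by left.
  by right; exists k, l.
- by exists ord_max, ord_max; rewrite !inE eqxx.
- exists (widen_ord (leqnSn n) i), (widen_ord (leqnSn m) j); split=> //.
  by rewrite !inE; apply/orP; right; apply/imsetP; exists (i, j).
Qed.

Lemma nrel_set0 n m x y : nrel (set0 : relation n m) x y <-> False.
Proof. by split=> // -[i [j [+ _ _]]]; rewrite inE. Qed.

Lemma nrel_eq n m x y :
  nrel (rel_eq n m) x y <-> x < n /\ y < m /\ x = y.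
Proof. by rewrite nrel_of; split=> -[? [? /eqP]]. Qed.

Lemma nrel_comp_eqr n m p (S : relation m p) x y :
  n = m -> nrel (rel_comp S (rel_eq n m)) x y <-> nrel S x y.
Proof.
move=> e; subst m; rewrite nrel_comp; split=> [[z [/nrel_eq[_ [_ <-]]]]|h] //.
by exists x; rewrite nrel_eq; have [] := nrel_bound h.
Qed.

Lemma nrel_comp_eql n m p (R : relation n m) x y :
  m = p -> nrel (rel_comp (rel_eq m p) R) x y <-> nrel R x y.
Proof.
move=> e; subst m.
rewrite nrel_comp; split=> [[z [h /nrel_eq[_ [_ <-]]]]|h] //.
by exists y; rewrite nrel_eq; have [] := nrel_bound h.
Qed.

Lemma rel_comp_eq n m p :
  n = m -> rel_comp (rel_eq m p) (rel_eq n m) = rel_eq n p.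
Proof. by move=> e; subst m; apply: nrelP => x y; rewrite nrel_comp_eqr. Qed.

Lemma rel_juxt_eq n m n' m' : n = m -> n' = m' ->
  rel_juxt (rel_eq n m) (rel_eq n' m') = rel_eq (n' + n) (m' + m).
Proof.
move=> e e'; subst m m'; apply: nrelP => x y.
by rewrite nrel_juxt !nrel_eq; lia.
Qed.

Lemma rel_lift_eq n m : n = m -> rel_lift (rel_eq n m) = rel_eq n.+1 m.+1.
Proof.
by move=> e; subst m; apply: nrelP => x y; rewrite nrel_lift !nrel_eq; lia.
Qed.

Lemma rel_comp_assoc n m p q (T : relation p q) (S : relation m p)
    (R : relation n m) :
  rel_comp (rel_comp T S) R = rel_comp T (rel_comp S R).
Proof.
apply: nrelP => x y; rewrite !nrel_comp; split.
  move=> [z [h /nrel_comp[w [h' h'']]]]; exists w; split=> //.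
  by apply/nrel_comp; exists z.
move=> [z [/nrel_comp[w [h' h'']]] h]; exists w; split=> //.
by apply/nrel_comp; exists z.
Qed.

Lemma rel_juxt_comp n m p n' m' p' (S : relation m p) (R : relation n m)
    (S' : relation m' p') (R' : relation n' m') :
  rel_juxt (rel_comp S R) (rel_comp S' R')
  = rel_comp (rel_juxt S S') (rel_juxt R R').
Proof.
apply: nrelP => x y; rewrite nrel_juxt !nrel_comp; split.
  case=> [[z [h h']]|[lx [ly [z [h h']]]]].
    by exists z; split; apply/nrel_juxt; left.
  exists (m' + z); split; apply/nrel_juxt; right; by rewrite leq_addr addKn.
case=> z [/nrel_juxt[h|[lx [lz h]]] /nrel_juxt[h'|[lz' [ly h']]]].
- by left; exists z.
- by have [] := nrel_bound h; lia.
- by have [] := nrel_bound h'; lia.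
- by right; do 2 split=> //; exists (z - m').
Qed.

Lemma rel_lift_comp n m p (S : relation m p) (R : relation n m) :
  rel_lift (rel_comp S R) = rel_comp (rel_lift S) (rel_lift R).
Proof.
apply: nrelP => x y; rewrite nrel_lift !nrel_comp; split.
  case=> [[-> ->]|[z [h h']]].
    by exists m; split; apply/nrel_lift; left.
  by exists z; split; apply/nrel_lift; right.
case=> z [/nrel_lift[[ex ez]|h] /nrel_lift[[ez' ey]|h']].
- by left.
- by have [] := nrel_bound h'; lia.
- by have [] := nrel_bound h; lia.
- by right; exists z.
Qed.

Lemma rel_juxtA n1 m1 n2 m2 n3 m3 (R1 : relation n1 m1) (R2 : relation n2 m2)
    (R3 : relation n3 m3) x y :
  nrel (rel_juxt (rel_juxt R1 R2) R3) x y
  <-> nrel (rel_juxt R1 (rel_juxt R2 R3)) x y.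
Proof.
rewrite !nrel_juxt !subnDA; split.
  case=> [h|[lx [ly [h|[lx' [ly' h]]]]]]; [by do 2 left|by left; right|right].
  by do !split=> //; lia.
case=> [[h|[lx [ly h]]]|[lx [ly h]]]; [by left|right..].
  by do 2 split=> //; left.
by do !(split; first lia); right; do !(split; first lia).
Qed.

Lemma psi_relP a b i j : psi_rel a b i j ->
  i < b /\ j = i \/ i = b /\ j = b + a \/ b < i <= b + a /\ i = j.+1 \/
  i = b.+1 + a /\ j = b + a.
Proof.
by rewrite /psi_rel; lia.
Qed.

Lemma G_psi_nat a a' b b' (f : relation a a') (g : relation b b') :
  rel_comp (rel_of (b'.+1 + a'.+1) (b' + a').+1 (psi_rel a' b'))
    (rel_juxt (rel_lift f) (rel_lift g))
  = rel_comp (rel_lift (rel_juxt f g))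
      (rel_of (b.+1 + a.+1) (b + a).+1 (psi_rel a b)).
Proof.
apply: nrelP => x y; rewrite !nrel_comp; split.
  case=> z [/nrel_juxt h /nrel_of[lz [ly /psi_relP e]]].
  case: h => [/nrel_lift[[ex ez]|h]|[lx [lz' /nrel_lift[[ex ez]|h]]]].
  - exists (b + a); rewrite nrel_of nrel_lift /psi_rel.
    by split; [lia|left; lia].
  - have [bx bz] := nrel_bound h; have ? : y = z by lia.
    subst y; exists x; rewrite nrel_of nrel_lift nrel_juxt /psi_rel.
    by split; [lia|right; left].
  - exists (b + a); rewrite nrel_of nrel_lift /psi_rel.
    by split; [lia|left; lia].
  have [bx bz] := nrel_bound h; have ? : z = y.+1 by lia.
  subst z; exists x.-1; rewrite nrel_of nrel_lift nrel_juxt /psi_rel.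
  split; first lia.
  right; right; do !(split; first lia).
  by have -> : x.-1 - b = x - b.+1 by lia.
case=> z [/nrel_of[lx [lz /psi_relP e]]].
case/nrel_lift=> [[ez ey]|/nrel_juxt[h|[lz' [ly h]]]].
- case: (eqVneq x b) => ex.
    exists b'; rewrite nrel_of nrel_juxt !nrel_lift /psi_rel.
    by split; [left; left|]; lia.
  exists (b'.+1 + a'); rewrite nrel_of nrel_juxt !nrel_lift /psi_rel.
  by split; [right; do !(split; first lia); left|]; lia.
- have [bz bx] := nrel_bound h; have ? : x = z by lia.
  subst z; exists y; rewrite nrel_of nrel_juxt nrel_lift /psi_rel.
  by split; [left; right|lia].
have [bz by_] := nrel_bound h; have ? : x = z.+1 by lia.
subst x; exists y.+1; rewrite nrel_of nrel_juxt !nrel_lift /psi_rel.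
split; last lia.
by right; do !(split; first lia); rewrite !subSS; right.
Qed.

Lemma G_psi_assoc a b c x y :
  nrel (rel_comp (rel_of (c.+1 + (b + a).+1) (c + (b + a)).+1
                    (psi_rel (b + a) c))
          (rel_juxt (rel_of (b.+1 + a.+1) (b + a).+1 (psi_rel a b))
                    (rel_eq c.+1 c.+1))) x y
  <-> nrel (rel_comp (rel_of ((c + b).+1 + a.+1) (c + b + a).+1
                        (psi_rel a (c + b)))
              (rel_juxt (rel_eq a.+1 a.+1)
                 (rel_of (c.+1 + b.+1) (c + b).+1 (psi_rel b c)))) x y.
Proof.
rewrite !nrel_comp; split.
  case=> z [/nrel_juxt]; rewrite nrel_eq nrel_of => h.
  case/nrel_of=> lz [ly /psi_relP e].
  have {}h : z = x /\ x <= c \/ c < x /\ c < z /\ x < c + a + b + 3 /\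
    (x <= c + b /\ z = x \/ x = c.+1 + b /\ z = c.+1 + b + a \/
      c.+1 + b < x <= c + b + a + 1 /\ x = z.+1
      \/ x = c + b + a + 2 /\ z = c.+1 + b + a).
    case: h => [|[? [? [? [? /psi_relP]]]]]; lia.
  case: (ltnP x c) => h1.
    by exists x; rewrite nrel_juxt nrel_eq !nrel_of /psi_rel; lia.
  case: (eqVneq x c) => h2.
    by exists (c + b); rewrite nrel_juxt nrel_eq !nrel_of /psi_rel; lia.
  case: (eqVneq x (c.+1 + b)) => h3.
    by exists (c + b); rewrite nrel_juxt nrel_eq !nrel_of /psi_rel; lia.
  by exists x.-1; rewrite nrel_juxt nrel_eq !nrel_of /psi_rel; lia.
case=> z [/nrel_juxt]; rewrite nrel_eq nrel_of => h.
case/nrel_of=> lz [ly /psi_relP e].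
have {}h : (x < c.+1 + b.+1 /\ z < (c + b).+1 /\
    (x < c /\ z = x \/ x = c /\ z = c + b \/ c < x <= c + b /\ x = z.+1
    \/ x = c.+1 + b /\ z = c + b))
  \/ c.+1 + b.+1 <= x /\ x < c + b + a + 3 /\ x = z.+1.
  case: h => [[? [? /psi_relP]]|]; lia.
case: (leqP x (c + b)) => h1.
  by exists x; rewrite nrel_juxt nrel_eq !nrel_of /psi_rel; lia.
case: (eqVneq x (c.+1 + b)) => h3.
  by exists (c + b + a).+1; rewrite nrel_juxt nrel_eq !nrel_of /psi_rel; lia.
by exists x.-1; rewrite nrel_juxt nrel_eq !nrel_of /psi_rel; lia.
Qed.

Lemma G_delta_psi a b
    (d := fun n i j : nat => (i == j) || ((i == n) && (j == n.+1))) :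
  rel_comp (rel_of (b + a).+1 (b + a).+2 (d (b + a)))
    (rel_of (b.+1 + a.+1) (b + a).+1 (psi_rel a b))
  = rel_comp (rel_comp
        (rel_lift (rel_of (b.+1 + a.+1) (b + a).+1 (psi_rel a b)))
        (rel_of (b.+2 + a.+2) (b.+1 + a.+1).+1 (psi_rel a.+1 b.+1)))
      (rel_juxt (rel_of a.+1 a.+2 (d a)) (rel_of b.+1 b.+2 (d b))).
Proof.
apply: nrelP => x y; rewrite !nrel_comp; split.
  case=> z [/nrel_of[lx [lz /psi_relP e]]] /nrel_of[_ [ly e']].
  have wit z1 z2 : nrel (rel_juxt (rel_of a.+1 a.+2 (d a))
        (rel_of b.+1 b.+2 (d b))) x z1 ->
      nrel (rel_of (b.+2 + a.+2) (b.+1 + a.+1).+1 (psi_rel a.+1 b.+1)) z1 z2 ->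
      nrel (rel_lift (rel_of (b.+1 + a.+1) (b + a).+1 (psi_rel a b))) z2 y ->
      exists z0, nrel (rel_juxt (rel_of a.+1 a.+2 (d a))
        (rel_of b.+1 b.+2 (d b))) x z0 /\
      nrel (rel_comp (rel_lift (rel_of (b.+1 + a.+1) (b + a).+1 (psi_rel a b)))
        (rel_of (b.+2 + a.+2) (b.+1 + a.+1).+1 (psi_rel a.+1 b.+1))) z0 y.
    by move=> h1 h2 h3; exists z1; split=> //; apply/nrel_comp; exists z2.
  have {}e' : y = z \/ z = b + a /\ y = (b + a).+1 by move: e'; rewrite /d; lia.
  case: e => [e|[e|[e|e]]].
  - by apply: (wit x x); rewrite ?(nrel_juxt, nrel_lift, nrel_of) /d /psi_rel;
      lia.
  - case: e' => [e'|[_ e']].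
      by apply: (wit b b); rewrite ?(nrel_juxt, nrel_lift, nrel_of) /d /psi_rel;
        lia.
    by apply: (wit b.+1 (b + a.+2));
      rewrite ?(nrel_juxt, nrel_lift, nrel_of) /d /psi_rel; lia.
  - by apply: (wit x.+1 x);
      rewrite ?(nrel_juxt, nrel_lift, nrel_of) /d /psi_rel; lia.
  - case: e' => [e'|[_ e']].
      by apply: (wit (b + a.+2) (b + a.+1));
        rewrite ?(nrel_juxt, nrel_lift, nrel_of) /d /psi_rel; lia.
    by apply: (wit (b + a.+3) (b + a.+2));
      rewrite ?(nrel_juxt, nrel_lift, nrel_of) /d /psi_rel; lia.
case=> z1 [/nrel_juxt]; rewrite !nrel_of => h1.
case/nrel_comp=> z2 [/nrel_of[l1 [l2 /psi_relP e]]].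
rewrite nrel_lift nrel_of => h2.
have {}h2 : z2 = b.+1 + a.+1 /\ y = (b + a).+1 \/
  z2 < b.+1 + a.+1 /\ y < (b + a).+1 /\
  (z2 < b /\ y = z2 \/ z2 = b /\ y = b + a \/
   b < z2 <= b + a /\ z2 = y.+1 \/ z2 = b.+1 + a /\ y = b + a).
  by case: h2 => [|[? [? /psi_relP]]]; lia.
have {}h1 :
  x < b.+1 /\ z1 < b.+2 /\ (z1 = x \/ x = b /\ z1 = b.+1) \/
  b.+1 <= x /\ x < b.+1 + a.+1 /\ z1 < b + a + 4 /\
    (z1 = x.+1 \/ x = b.+1 + a /\ z1 = b + a + 3).
  by move: h1; rewrite /d; lia.
case: h1 => h1.
  case: (ltnP x b) => h.
    by exists x; rewrite !nrel_of /d /psi_rel; lia.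
  by exists (b + a); rewrite !nrel_of /d /psi_rel; lia.
case: (eqVneq x (b.+1 + a)) => h.
  by exists (b + a); rewrite !nrel_of /d /psi_rel; lia.
by exists x.-1; rewrite !nrel_of /d /psi_rel; lia.
Qed.

Lemma Garr_sound P (A B : ob P) (f g : arr A B) :
  f ≈ g -> Garr f = Garr g.
Proof.
elim=> {A B f g} /=.
- by [].
- by [].
- by move=> A B f g h _ -> _ ->.
- by move=> A B C g g' f f' _ -> _ ->.
- by move=> A A' B B' f f' g g' _ -> _ ->.
- by move=> A B f f' _ ->.
- by move=> A B f; apply: nrelP => x y; apply: nrel_comp_eql.
- by move=> A B f; apply: nrelP => x y; apply: nrel_comp_eqr.
- by move=> *; apply: rel_comp_assoc.
- by move=> A B; rewrite rel_juxt_eq.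
- by move=> *; apply: rel_juxt_comp.
- by move=> A; rewrite rel_lift_eq.
- by move=> *; apply: rel_lift_comp.
- move=> A A' B B' C C' f g h; apply: nrelP => x y.
  rewrite nrel_comp_eql ?nrel_comp_eqr ?addnA //.
  exact: rel_juxtA.
- move=> A A' f; apply: nrelP => x y.
  rewrite nrel_comp_eql ?nrel_comp_eqr ?addn0 // nrel_juxt nrel_eq.
  by split=> [[//|]|]; [lia|left].
- move=> A A' f; apply: nrelP => x y.
  rewrite nrel_comp_eql ?nrel_comp_eqr // nrel_juxt nrel_eq !subn0.
  by split=> [[|[_ []]]|] //; [lia|right].
- move=> A A' f; apply: nrelP => x y; rewrite !nrel_comp; split.
    case=> z [/nrel_lift h /nrel_eq[lz [ly e]]]; subst z.
    case: h => [[_ e]|h]; first lia.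
    exists x; rewrite nrel_eq; have [] := nrel_bound h; do !split=> //; lia.
  case=> z [/nrel_eq[lx [lz <-]] h]; exists y.
  rewrite nrel_lift nrel_eq; have [] := nrel_bound h.
  by do !split; [right|lia..].
- move=> A A' f; apply: nrelP => x y; rewrite !nrel_comp; split.
    case=> z [/nrel_lift h /nrel_of[lz [ly e]]].
    case: h => [[ex ez]|h].
      subst x z; case: (eqVneq y (Gob A')) => ey.
        exists (Gob A); split; first by apply/nrel_of; lia.
        by apply/nrel_lift; right; apply/nrel_lift; left.
      exists (Gob A).+1; split; first by apply/nrel_of; lia.
      by apply/nrel_lift; left; lia.
    have [bx bz] := nrel_bound h; have ? : y = z by lia.
    subst y; exists x; split; first by apply/nrel_of; lia.
    by apply/nrel_lift; right; apply/nrel_lift; right.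
  case=> z [/nrel_of[lz [ly e]]] /nrel_lift[[ez ey]|].
    by exists (Gob A'); split; [apply/nrel_lift; left|apply/nrel_of]; lia.
  case/nrel_lift=> [[ez ey]|h].
    by exists (Gob A'); split; [apply/nrel_lift; left|apply/nrel_of]; lia.
  have [bx bz] := nrel_bound h; have ? : x = z by lia.
  by subst z; exists y; split; [apply/nrel_lift; right|apply/nrel_of; lia].
- by move=> A A' B B' f g; apply: G_psi_nat.
- by move=> A B C; rewrite rel_comp_eq // addnA.
- by move=> A B C; rewrite rel_comp_eq // addnA.
- by move=> A; rewrite rel_comp_eq // addn0.
- by move=> A; rewrite rel_comp_eq // addn0.
- by move=> A; rewrite rel_comp_eq.
- by move=> A; rewrite rel_comp_eq.
- by move=> A B C D; rewrite !(rel_juxt_eq, rel_comp_eq) //= !addnA.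
- by move=> A B; rewrite !(rel_juxt_eq, rel_comp_eq) //= ?addn0 ?addnA.
- move=> A; apply: nrelP => x y; rewrite nrel_comp nrel_eq; split.
    by case=> z [/nrel_of h /nrel_eq h']; lia.
  by move=> h; exists x; rewrite nrel_eq nrel_of; lia.
- move=> A; apply: nrelP => x y; rewrite nrel_comp nrel_eq; split.
    by case=> z [/nrel_of h /nrel_lift h']; move: h'; rewrite nrel_eq; lia.
  move=> h; exists (if x == Gob A then x.+1 else x).
  by rewrite nrel_of nrel_lift nrel_eq; case: eqP; lia.
- move=> A; apply: nrelP => x y; rewrite !nrel_comp; split.
    case=> z [/nrel_of h /nrel_of h'].
    exists (if y == (Gob A).+2 then (Gob A).+1 else x).
    by rewrite nrel_lift !nrel_of; case: eqP; lia.
  case=> z [/nrel_of h /nrel_lift]; rewrite nrel_of => h'.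
  exists (if (x == Gob A) && (y != Gob A) then (Gob A).+1 else x).
  by rewrite !nrel_of; case: ifP; lia.
- move=> A B C; rewrite rel_lift_eq ?addnA // rel_comp_assoc.
  apply: nrelP => x y; rewrite nrel_comp_eql ?addnA //.
  by rewrite nrel_comp_eqr /= ?addnA //; apply: G_psi_assoc.
- move=> A; rewrite rel_lift_eq ?addn0 // rel_comp_assoc.
  apply: nrelP => x y; rewrite nrel_comp_eql ?addn0 // nrel_comp nrel_eq.
  split.
    case=> z [/nrel_juxt]; rewrite nrel_set0 nrel_eq => h.
    by case/nrel_of; rewrite /psi_rel; lia.
  move=> h; exists x; rewrite nrel_juxt nrel_set0 nrel_eq nrel_of /psi_rel.
  lia.
- move=> A; rewrite rel_lift_eq // rel_comp_assoc.
  apply: nrelP => x y; rewrite nrel_comp_eql // nrel_comp nrel_eq.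
  split.
    case=> z [/nrel_juxt]; rewrite nrel_set0 nrel_eq => h.
    by case/nrel_of; rewrite /psi_rel; lia.
  move=> h; exists x.+1; rewrite nrel_juxt nrel_set0 nrel_eq nrel_of /psi_rel.
  lia.
- move=> A B; apply: nrelP => x y; rewrite nrel_comp nrel_juxt !nrel_eq.
  rewrite /psi_rel; split.
    by case=> z [/nrel_of h /nrel_eq h']; move: h; rewrite /psi_rel; lia.
  by move=> h; exists y; rewrite nrel_eq nrel_of /psi_rel; lia.
- by move=> A B; apply: G_delta_psi.
- apply: nrelP => x y; rewrite nrel_comp nrel_eq.
  by split=> [[z [/nrel_set0]]|] //; lia.
- apply: nrelP => x y; rewrite !nrel_comp.
  by split=> -[z [/nrel_set0]].
Qed.

Lemma Garr_id P (A : ob P) : Garr (𝟏 A) = rel_eq (Gob A) (Gob A).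
Proof. by []. Qed.

Lemma Garr_comp P (A B C : ob P) (g : arr B C) (f : arr A B) :
  Garr (g ∘ f) = rel_comp (Garr g) (Garr f).
Proof. by []. Qed.

Lemma rel_comp_congr n m p (S S' : relation m p) (R R' : relation n m) :
  S = S' -> R = R' -> rel_comp S R = rel_comp S' R'.
Proof. by move=> -> ->. Qed.

Lemma rel_comp_idl n m (R : relation n m) : rel_comp (rel_eq m m) R = R.
Proof. by apply: nrelP => x y; apply: nrel_comp_eql. Qed.

Lemma rel_comp_idr n m (R : relation n m) : rel_comp R (rel_eq n n) = R.
Proof. by apply: nrelP => x y; apply: nrel_comp_eqr. Qed.

Definition Rel : category :=
  @Category nat relation (fun n m => eq) (fun n => rel_eq n n) rel_comp
    (fun n m => @erefl _) (fun n m => @esym _) (fun n m => @etrans _)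
    rel_comp_congr rel_comp_idl rel_comp_idr
    (fun n m p q T S R => rel_comp_assoc T S R).

Definition G (P : Type) : functor (MSco P) Rel :=
  @Functor (MSco P) Rel (@Gob P) (@Garr P) (@Garr_sound P)
    (@Garr_id P) (@Garr_comp P).

(* Main.v *)
From mathcomp Require Import all_boot zify.
From Stdlib Require Import Setoid Morphisms Eqdep.
Require Import Defs.
Set Implicit Arguments.
Unset Strict Implicit.
Unset Printing Implicit Defensive.

(** The proof separates the counits [eps] from everything else, and uses the
    fact that without them every arrow into [L B] is the cofree extension of
    its composite with [eps B].

    Counits can be pushed to the source side of any arrow term, because
    composing [eps] after [delta], [psi] or [psi0] either cancels or gives
    counits before the other arrows ([erase_commute]).  So every arrow is
    [h ∘ erase m], where [erase m] deletes the occurrences of [L] not selected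
    by a mask [m] and the term [h] is free of counits
    ([eps_factorization]).  The relation of an eps-free [h] is total, so the
    relation of [h ∘ erase m] determines [m] as its domain; as [erase m] is
    sent to a surjective partial function, it determines the relation of [h]
    too.  Faithfulness therefore only has to be checked on eps-free terms
    ([faithful_reduction]).

    The rest is an induction on the target ([Garr_inj]).  An object all of
    whose outermost atoms are of the form [L X] carries a canonical coalgebra
    structure, made of [delta], [psi] and [psi0].  An eps-free [h : A -> L B]
    forces such a structure [a] on [A] and is a coalgebra morphism for it, so
    that [h ≈ L (eps ∘ h) ∘ a] by the universal property of the cofree
    coalgebra [L B] ([eps_free_cofree]); the arrow [eps ∘ h] has the smaller
    target [B].  An eps-free arrow into [B1 ⊗ B2] is a tensor product
    [h1 ⊗ h2] up to a structural isomorphism of the source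
    ([eps_free_decomposed]).  Its relation and the number of generating
    objects in [B1] tell where the source is split ([tensor_split_size],
    [structural_split]).  An eps-free arrow into [I] or into a generating
    object is structural, and Mac Lane's coherence theorem applies
    ([structural_coherence]). *)

(** * Rewriting modulo the equations *)

#[local] Instance eqarr_equiv P (A B : ob P) : Equivalence (@eqarr P A B).
Proof.
split; [exact: eqarr_refl|exact: eqarr_sym|exact: eqarr_trans].
Qed.

#[local] Instance Comp_proper P (A B C : ob P) :
  Proper (@eqarr P B C ==> @eqarr P A B ==> @eqarr P A C) (@Comp P A B C).
Proof. by move=> g g' hg f f' hf; apply: Comp_congr. Qed.

#[local] Instance TenA_proper P (A A' B B' : ob P) :
  Proper (@eqarr P A A' ==> @eqarr P B B' ==> @eqarr P (A ⊗ B) (A' ⊗ B'))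
    (@TenA P A A' B B').
Proof. by move=> f f' hf g g' hg; apply: TenA_congr. Qed.

#[local] Instance LA_proper P (A B : ob P) :
  Proper (@eqarr P A B ==> @eqarr P (L A) (L B)) (@LA P A B).
Proof. by move=> f f' hf; apply: LA_congr. Qed.

#[local] Hint Resolve eqarr_refl : core.

Lemma comp_tail P (A B C D : ob P) (g : arr B C) (f : arr A B) (k : arr A C)
    (x : arr D A) : g ∘ f ≈ k -> g ∘ (f ∘ x) ≈ k ∘ x.
Proof. by rewrite -Comp_assoc => ->. Qed.

Lemma comp_tail2 P (A B B' C D : ob P) (g : arr B C) (f : arr A B)
    (g' : arr B' C) (f' : arr A B')
    (x : arr D A) : g ∘ f ≈ g' ∘ f' -> g ∘ (f ∘ x) ≈ g' ∘ (f' ∘ x).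
Proof. by rewrite -!Comp_assoc => ->. Qed.

(** * Coherence for the monoidal structure *)

Lemma id_ten_comp P (A B B' B'' : ob P) (g : arr B' B'') (f : arr B B') :
  (𝟏 A ⊗ (g ∘ f) ≈ (𝟏 A ⊗ g) ∘ (𝟏 A ⊗ f))%arr.
Proof. by rewrite -TenA_comp Comp_idl. Qed.

Lemma assocV_nat P (A A' B B' C C' : ob P) (f : arr A A') (g : arr B B')
    (h : arr C C') :
  assocV A' B' C' ∘ (f ⊗ (g ⊗ h)) ≈ ((f ⊗ g) ⊗ h) ∘ assocV A B C.
Proof.
rewrite -(Comp_idr (_ ⊗ (_ ⊗ _))%arr) -(assocVK A B C).
rewrite -(Comp_assoc (_ ⊗ (_ ⊗ _))%arr) -assoc_nat -!Comp_assoc assocK.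
by rewrite Comp_idl.
Qed.

Lemma lunitV_nat P (A A' : ob P) (f : arr A A') :
  lunitV A' ∘ f ≈ (𝟏 I ⊗ f) ∘ lunitV A.
Proof.
rewrite -{1}(Comp_idr f) -(lunitVK A) -(Comp_assoc f) -lunit_nat.
by rewrite -!Comp_assoc lunitK Comp_idl.
Qed.

Lemma runitV_nat P (A A' : ob P) (f : arr A A') :
  runitV A' ∘ f ≈ (f ⊗ 𝟏 I) ∘ runitV A.
Proof.
rewrite -{1}(Comp_idr f) -(runitVK A) -(Comp_assoc f) -runit_nat.
by rewrite -!Comp_assoc runitK Comp_idl.
Qed.

(** Kelly's derivation of this coherence law: since [I ⊗ -] is faithful, it
    is enough to compare both sides after tensoring with [I] on the left and
    composing with isomorphisms, and there the pentagon reduces the claim to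
    the triangle. *)
Lemma lunit_ten P (A B : ob P) :
  lunit (A ⊗ B) ∘ assoc I A B ≈ (lunit A ⊗ 𝟏 B)%arr.
Proof.
have I_inj (X Y : ob P) (f g : arr X Y) :
    (𝟏 I ⊗ f ≈ 𝟏 I ⊗ g)%arr -> f ≈ g.
  move=> e; rewrite -(Comp_idr f) -(Comp_idr g) -(lunitVK X) -!Comp_assoc.
  by rewrite -!lunit_nat e.
have cancel_iso (X Y Z : ob P) (i : arr X Y) (j : arr Y X) (f g : arr Y Z) :
   i ∘ j ≈ 𝟏 Y -> f ∘ i ≈ g ∘ i -> f ≈ g.
  move=> ij e; rewrite -(Comp_idr f) -(Comp_idr g) -ij -!Comp_assoc.
  by rewrite e.
apply: I_inj.
apply: (cancel_iso _ _ _ (assoc I (I ⊗ A) B) (assocV _ _ _)).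
  exact: assocVK.
apply: (cancel_iso _ _ _ (assoc I I A ⊗ 𝟏 B)%arr (assocV I I A ⊗ 𝟏 B)%arr).
  by rewrite -TenA_comp assocVK Comp_idl TenA_id.
rewrite -{1}(Comp_idl (𝟏 I)) TenA_comp !Comp_assoc.
rewrite -(Comp_assoc (𝟏 I ⊗ assoc _ _ _)%arr).
rewrite -pentagon -Comp_assoc triangle -(TenA_id A B) -assoc_nat.
rewrite -!Comp_assoc -assoc_nat !Comp_assoc -TenA_comp triangle.
by rewrite Comp_idl.
Qed.

Fixpoint structural P (A B : ob P) (f : arr A B) : bool :=
  match f with
  | Comp _ _ _ g f => structural g && structural f
  | TenA _ _ _ _ f g => structural f && structural g
  | Id _ | assoc _ _ _ | assocV _ _ _ | lunit _ | lunitV _ | runit _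
  | runitV _ => true
  | _ => false
  end.

Fixpoint tensor_list P (l : seq (ob P)) : ob P :=
  if l is A :: l' then (A ⊗ tensor_list l')%ob else I.

(** The atoms of [A] (generators and objects [L X]) followed by [l].  With the
    accumulator, the sources and targets of [assoc], [lunit] and [runit] have
    convertible lists of atoms, so no transport occurs in their case of
    [norm_structural]. *)
Fixpoint flatten_onto P (A : ob P) (l : seq (ob P)) : seq (ob P) :=
  match A with
  | Ten A B => flatten_onto A (flatten_onto B l)
  | I => l
  | A => A :: l
  end.

Fixpoint norm P (A : ob P) (l : seq (ob P)) :
    arr (A ⊗ tensor_list l) (tensor_list (flatten_onto A l)) :=
  match A with
  | Ten A B =>
      norm A (flatten_onto B l) ∘ (𝟏 A ⊗ norm B l) ∘ assoc A B (tensor_list l)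
  | I => lunit (tensor_list l)
  | A => 𝟏 (A ⊗ tensor_list l)
  end%arr.

Fixpoint normV P (A : ob P) (l : seq (ob P)) :
    arr (tensor_list (flatten_onto A l)) (A ⊗ tensor_list l) :=
  match A with
  | Ten A B =>
      assocV A B (tensor_list l) ∘ (𝟏 A ⊗ normV B l)
        ∘ normV A (flatten_onto B l)
  | I => lunitV (tensor_list l)
  | A => 𝟏 (A ⊗ tensor_list l)
  end%arr.

Lemma normK P (A : ob P) l : normV A l ∘ norm A l ≈ 𝟏 (A ⊗ tensor_list l).
Proof.
elim: A l => [p||A IHA B IHB|A _] l /=; rewrite ?Comp_idl ?lunitK //.
rewrite !Comp_assoc (comp_tail _ (IHA _)) Comp_idl.
rewrite -(Comp_assoc (𝟏 A ⊗ normV B l)%arr) -TenA_comp IHB Comp_idl TenA_id.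
by rewrite Comp_idl assocK.
Qed.

Lemma structural_norm P (A : ob P) l : structural (norm A l).
Proof. by elim: A l => //= A IHA B IHB l; rewrite IHA IHB. Qed.

Lemma structural_normV P (A : ob P) l : structural (normV A l).
Proof. by elim: A l => //= A IHA B IHB l; rewrite IHA IHB. Qed.

(** The lists of atoms on the two sides of an arbitrary structural arrow are
    equal, but only provably so. *)
Definition castl P (l l' : seq (ob P)) (q : l = l') :
    arr (tensor_list l) (tensor_list l') :=
  match q with erefl => 𝟏 (tensor_list l) end.

Lemma norm_castl P (A : ob P) l l' (q : l = l') :
  norm A l' ∘ (𝟏 A ⊗ castl q)
  ≈ castl (congr1 (flatten_onto A) q) ∘ norm A l.
Proof. by case: l' / q => /=; rewrite TenA_id Comp_idl Comp_idr. Qed.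

Lemma castl_comp P (l l' l'' : seq (ob P)) (q : l = l') (q' : l' = l'') :
  castl q' ∘ castl q ≈ castl (etrans q q').
Proof. by case: l'' / q'; case: l' / q; rewrite /= Comp_idl. Qed.

Lemma norm_inverse P (A B : ob P) l (s : arr A B) (t : arr B A) :
  s ∘ t ≈ 𝟏 B ->
  (exists q : flatten_onto A l = flatten_onto B l,
    norm B l ∘ (s ⊗ 𝟏 (tensor_list l)) ≈ castl q ∘ norm A l) ->
  exists q : flatten_onto B l = flatten_onto A l,
    norm A l ∘ (t ⊗ 𝟏 (tensor_list l)) ≈ castl q ∘ norm B l.
Proof.
move=> st [q e]; exists (esym q).
have -> : norm B l ≈ castl q ∘ norm A l ∘ (t ⊗ 𝟏 (tensor_list l)).
  by rewrite -e Comp_assoc -TenA_comp st Comp_idl TenA_id Comp_idr.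
rewrite -!Comp_assoc castl_comp.
by case: _ / q {e} => /=; rewrite Comp_idl.
Qed.

Lemma norm_assoc P (A B C : ob P) l :
  norm (A ⊗ (B ⊗ C)) l ∘ (assoc A B C ⊗ 𝟏 (tensor_list l))
  ≈ norm ((A ⊗ B) ⊗ C) l.
Proof.
have -> : norm ((A ⊗ B) ⊗ C)%ob l
    ≈ norm A (flatten_onto B (flatten_onto C l))
      ∘ ((𝟏 A ⊗ norm B (flatten_onto C l))
        ∘ ((𝟏 A ⊗ (𝟏 B ⊗ norm C l)) ∘
           (assoc A B (C ⊗ tensor_list l)
              ∘ assoc (A ⊗ B) C (tensor_list l)))).
  rewrite /= !Comp_assoc -(TenA_id A B).
  by rewrite (comp_tail2 _ (assoc_nat _ _ _)).
by rewrite pentagon /= !id_ten_comp !Comp_assoc.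
Qed.

Lemma norm_lunit P (A : ob P) l :
  norm A l ∘ (lunit A ⊗ 𝟏 (tensor_list l)) ≈ norm (I ⊗ A)%ob l.
Proof. by rewrite -lunit_ten -Comp_assoc -lunit_nat. Qed.

Lemma norm_runit P (A : ob P) l :
  norm A l ∘ (runit A ⊗ 𝟏 (tensor_list l)) ≈ norm (A ⊗ I)%ob l.
Proof. by rewrite -triangle -Comp_assoc. Qed.

(** Structural arrows become identities after normalization.  This is stated
    with an arbitrary [l] on the right because the left factor of a tensor
    product is normalized in front of the atoms of the right factor. *)
Lemma norm_structural P (A B : ob P) (s : arr A B) : structural s ->
  forall l, exists q : flatten_onto A l = flatten_onto B l,
    norm B l ∘ (s ⊗ 𝟏 (tensor_list l)) ≈ castl q ∘ norm A l.
Proof.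
elim: A B / s => //=.
- by move=> A _ l; exists erefl; rewrite TenA_id Comp_idl Comp_idr.
- move=> A B C t IHt s IHs /andP[/IHt{}IHt /IHs{}IHs] l.
  have [q e] := IHs l; have [q' e'] := IHt l; exists (etrans q q').
  rewrite -{1}(Comp_idl (𝟏 _)) TenA_comp -Comp_assoc e' Comp_assoc e.
  by rewrite -Comp_assoc castl_comp.
- move=> A A' B B' s IHs t IHt /andP[/IHs{}IHs /IHt{}IHt] l.
  have [q e] := IHt l; have [q' e'] := IHs (flatten_onto B' l).
  exists (etrans (congr1 (flatten_onto A) q) q').
  rewrite Comp_assoc assoc_nat !Comp_assoc.
  rewrite -(Comp_assoc (𝟏 A' ⊗ norm B' l)%arr) -TenA_comp Comp_idl e.
  have -> : (s ⊗ (castl q ∘ norm B l)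
      ≈ (s ⊗ 𝟏 _) ∘ ((𝟏 A ⊗ castl q) ∘ (𝟏 A ⊗ norm B l)))%arr.
    by rewrite -!TenA_comp !Comp_idl Comp_idr.
  rewrite -!Comp_assoc e' (Comp_assoc (castl q')) norm_castl.
  by rewrite -(Comp_assoc (castl q')) castl_comp.
- by move=> A B C _ l; exists erefl; rewrite norm_assoc Comp_idl.
- move=> A B C _ l; apply: (norm_inverse (assocVK _ _ _)); exists erefl.
  by rewrite norm_assoc Comp_idl.
- by move=> A _ l; exists erefl; rewrite norm_lunit Comp_idl.
- move=> A _ l; apply: (norm_inverse (lunitVK _)); exists erefl.
  by rewrite norm_lunit Comp_idl.
- by move=> A _ l; exists erefl; rewrite norm_runit Comp_idl.
- move=> A _ l; apply: (norm_inverse (runitVK _)); exists erefl.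
  by rewrite norm_runit Comp_idl.
Qed.

(** Mac Lane's coherence theorem, for objects whose atoms may be of the form
    [L X].  Two structural arrows give two equations between the same lists of
    atoms; they are identified by uniqueness of identity proofs, which is
    needed as [P] is an arbitrary type. *)
Lemma structural_coherence P (A B : ob P) (s t : arr A B) :
  structural s -> structural t -> s ≈ t.
Proof.
move=> /norm_structural/(_ [::])[q es] /norm_structural/(_ [::])[q' et].
have e : (s ⊗ 𝟏 I ≈ t ⊗ 𝟏 I)%arr.
  rewrite -(Comp_idl (s ⊗ _)%arr) -(Comp_idl (t ⊗ _)%arr) -(normK B [::]).
  by rewrite !Comp_assoc es et (UIP _ _ _ q q').
rewrite -(Comp_idr s) -(Comp_idr t) -(runitVK A) -!Comp_assoc -!runit_nat.
by rewrite e.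
Qed.

Lemma structural_castl P (l l' : seq (ob P)) (q : l = l') :
  structural (castl q).
Proof. by case: l' / q. Qed.

Lemma structural_exists P (A B : ob P) :
  flatten_onto A [::] = flatten_onto B [::] ->
  exists s : arr A B, structural s.
Proof.
move=> q.
exists (runit B ∘ normV B [::] ∘ castl q ∘ norm A [::] ∘ runitV A)%arr.
rewrite /= (structural_norm A [::]) (structural_normV B [::]).
by rewrite structural_castl.
Qed.

Lemma Garr_structural P (A B : ob P) (s : arr A B) : structural s ->
  Gob A = Gob B /\ Garr s = rel_eq (Gob A) (Gob B).
Proof.
elim: A B / s => //=; try by move=> *; split=> //; lia.
- move=> A B C t IHt s IHs /andP[/IHt[eB ->] /IHs[eA ->]].
  by rewrite rel_comp_eq // eA.
- move=> A A' B B' s IHs t IHt /andP[/IHs[eA ->] /IHt[eB ->]].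
  by rewrite rel_juxt_eq // eA eB.
Qed.

(** * Canonical coalgebras *)

(** The coalgebra structures that [delta], [psi] and [psi0] build on [A].  This
    is a predicate rather than a function of [A] since there is no such
    structure when one of the outermost atoms of [A] is a generator. *)
Fixpoint coalgebra P (A : ob P) : arr A (L A) -> Prop :=
  match A with
  | Gen _ => fun _ => False
  | I => fun a => a ≈ psi0
  | Ten A B => fun a =>
      exists b c, [/\ coalgebra b, coalgebra c & a ≈ psi A B ∘ (b ⊗ c)]
  | L A => fun a => a ≈ delta A
  end.

Lemma coalgebra_unique P (A : ob P) (a b : arr A (L A)) :
  coalgebra a -> coalgebra b -> a ≈ b.
Proof.
elim: A a b => [p||A IHA B IHB|A _] a b //=.
- by move=> -> ->.
- case=> a1 [a2 [h1 h2 ->]] [b1 [b2 [k1 k2 ->]]].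
  by rewrite (IHA _ _ h1 k1) (IHB _ _ h2 k2).
- by move=> -> ->.
Qed.

Lemma coalgebra_morph_inverse P (A B : ob P) (s : arr A B) (t : arr B A)
    (a : arr A (L A)) (b : arr B (L B)) :
  s ∘ t ≈ 𝟏 B -> t ∘ s ≈ 𝟏 A -> b ∘ s ≈ LA s ∘ a -> a ∘ t ≈ LA t ∘ b.
Proof.
move=> st ts e.
rewrite -(Comp_idr b) -st -(Comp_assoc b) e -!Comp_assoc -LA_comp ts LA_id.
by rewrite Comp_idl.
Qed.

Lemma coalgebra_assoc P (A B C : ob P) (a : arr A (L A)) (b : arr B (L B))
    (c : arr C (L C)) :
  psi A (B ⊗ C) ∘ (a ⊗ (psi B C ∘ (b ⊗ c))) ∘ assoc A B C
  ≈ LA (assoc A B C) ∘ (psi (A ⊗ B) C ∘ ((psi A B ∘ (a ⊗ b)) ⊗ c)).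
Proof.
rewrite -{1}(Comp_idl a) -{2}(Comp_idl c) !TenA_comp -!Comp_assoc.
by rewrite psi_assoc !Comp_assoc assoc_nat.
Qed.

Lemma coalgebra_lunit P (A : ob P) (a : arr A (L A)) :
  a ∘ lunit A ≈ LA (lunit A) ∘ (psi I A ∘ (psi0 ⊗ a)).
Proof.
rewrite -{2}(Comp_idl a) -{1}(Comp_idr psi0) TenA_comp -!Comp_assoc psi_lunit.
by rewrite lunit_nat.
Qed.

Lemma coalgebra_runit P (A : ob P) (a : arr A (L A)) :
  a ∘ runit A ≈ LA (runit A) ∘ (psi A I ∘ (a ⊗ psi0)).
Proof.
rewrite -{2}(Comp_idl a) -{1}(Comp_idr psi0) TenA_comp -!Comp_assoc psi_runit.
by rewrite runit_nat.
Qed.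

(** Structural arrows reflect the canonical coalgebra structure, and are
    coalgebra morphisms: these are the equations relating [psi] and [psi0] to
    the monoidal isomorphisms. *)
Lemma coalgebra_structural P (A B : ob P) (s : arr A B) : structural s ->
  forall b, coalgebra b -> exists2 a, coalgebra a & b ∘ s ≈ LA s ∘ a.
Proof.
elim: A B / s => //=.
- by move=> A _ b hb; exists b => //; rewrite LA_id Comp_idl Comp_idr.
- move=> A B C t IHt s IHs /andP[/IHt{}IHt /IHs{}IHs] c /IHt[b /IHs[a ha e] e'].
  by exists a => //; rewrite -Comp_assoc e' Comp_assoc e LA_comp Comp_assoc.
- move=> A A' B B' s IHs t IHt /andP[/IHs{}IHs /IHt{}IHt] b
    [b1 [b2 [/IHs[a1 h1 e1] /IHt[a2 h2 e2] e]]].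
  exists (psi A B ∘ (a1 ⊗ a2))%arr; first by exists a1, a2.
  by rewrite e Comp_assoc -TenA_comp e1 e2 TenA_comp -!Comp_assoc psi_nat.
- move=> A B C _ a' [a [b' [ha [b [c [hb hc e]] e']]]].
  exists (psi (A ⊗ B) C ∘ ((psi A B ∘ (a ⊗ b)) ⊗ c))%arr.
    by exists (psi A B ∘ (a ⊗ b))%arr, c; split=> //; exists a, b.
  by rewrite e' e; apply: coalgebra_assoc.
- move=> A B C _ a' [b' [c [[a [b [ha hb e]]] hc e']]].
  exists (psi A (B ⊗ C) ∘ (a ⊗ (psi B C ∘ (b ⊗ c))))%arr.
    by exists a, (psi B C ∘ (b ⊗ c))%arr; split=> //; exists b, c.
  apply: (coalgebra_morph_inverse (assocVK A B C) (assocK A B C)).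
  rewrite e' e; exact: coalgebra_assoc.
- move=> A _ a ha; exists (psi I A ∘ (psi0 ⊗ a))%arr; first by exists psi0, a.
  exact: coalgebra_lunit.
- move=> A _ a' [b [a [e ha e']]]; exists a => //.
  apply: (coalgebra_morph_inverse (lunitVK A) (lunitK A)).
  rewrite e' e; exact: coalgebra_lunit.
- move=> A _ a ha; exists (psi A I ∘ (a ⊗ psi0))%arr; first by exists a, psi0.
  exact: coalgebra_runit.
- move=> A _ a' [a [b [ha e e']]]; exists a => //.
  apply: (coalgebra_morph_inverse (runitVK A) (runitK A)).
  rewrite e' e; exact: coalgebra_runit.
Qed.

(** * The shape of arrows without counits *)

Fixpoint eps_free P (A B : ob P) (f : arr A B) : bool :=
  match f with
  | Comp _ _ _ g f => eps_free g && eps_free f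
  | TenA _ _ _ _ f g => eps_free f && eps_free g
  | LA _ _ f => eps_free f
  | eps _ => false
  | _ => true
  end.

(** What the target reveals of an eps-free arrow.  At [L B] it says that [h] is
    a morphism from the canonical coalgebra of its source to the cofree
    coalgebra [L B]; nothing is said about the inside of [h] there, because
    [h] is recovered from [eps B ∘ h]. *)
Fixpoint decomposed P (B A : ob P) : arr A B -> Prop :=
  match B with
  | Gen p => fun h => exists2 s, structural s & h ≈ s
  | I => fun h => exists2 s, structural s & h ≈ s
  | Ten B1 B2 => fun h =>
      exists A1 A2 (s : arr A (A1 ⊗ A2)) (h1 : arr A1 B1) (h2 : arr A2 B2),
        [/\ structural s, decomposed h1, decomposed h2 & h ≈ (h1 ⊗ h2) ∘ s]
  | L B => fun h =>
      exists2 a : arr A (L A), coalgebra a & delta B ∘ h ≈ LA h ∘ a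
  end.

Lemma decomposed_eq P (A B : ob P) (h k : arr A B) :
  h ≈ k -> decomposed h -> decomposed k.
Proof.
case: B h k => [p||B1 B2|B] h k e /=.
- by case=> s hs e'; exists s; rewrite -?e.
- by case=> s hs e'; exists s; rewrite -?e.
- case=> A1 [A2 [s [h1 [h2 [hs d1 d2 e']]]]].
  by exists A1, A2, s, h1, h2; split=> //; rewrite -e.
- by case=> a ha e'; exists a; rewrite -?e.
Qed.

Lemma decomposed_structural P (A' A B : ob P) (h : arr A B) (s : arr A' A) :
  decomposed h -> structural s -> decomposed (h ∘ s)%arr.
Proof.
move=> + hs; case: B h => [p||B1 B2|B] h /=.
- by case=> t ht e; exists (t ∘ s)%arr; [rewrite /= ht|rewrite e].
- by case=> t ht e; exists (t ∘ s)%arr; [rewrite /= ht|rewrite e].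
- case=> A1 [A2 [t [h1 [h2 [ht d1 d2 e]]]]].
  exists A1, A2, (t ∘ s)%arr, h1, h2.
  by split=> //=; [rewrite ht|rewrite e Comp_assoc].
- case=> b /(coalgebra_structural hs)[a ha e'] e; exists a => //.
  by rewrite -Comp_assoc e Comp_assoc e' LA_comp Comp_assoc.
Qed.

Lemma decomposed_id P (A : ob P) : decomposed (𝟏 A).
Proof.
elim: A => [p||A IHA B IHB|A _] /=.
- by exists (𝟏 (Gen p))%arr.
- by exists (𝟏 I)%arr.
- exists A, B, (𝟏 (A ⊗ B))%arr, (𝟏 A)%arr, (𝟏 B)%arr; split=> //.
  by rewrite TenA_id Comp_idl.
- by exists (delta A); rewrite ?LA_id ?Comp_idl ?Comp_idr.
Qed.

(** [LA g], [delta], [psi] and [psi0] are coalgebra morphisms, and monoidal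
    isomorphisms commute with the tensor factors by naturality. *)
Lemma eps_free_decomposed_comp P (B C : ob P) (g : arr B C) : eps_free g ->
  forall (A : ob P) (h : arr A B), decomposed h -> decomposed (g ∘ h)%arr.
Proof.
elim: B C / g => //=.
- by move=> B _ A h; apply: decomposed_eq; rewrite Comp_idl.
- move=> B C D g' IHg' g IHg /andP[/IHg'{}IHg' /IHg{}IHg] A h /IHg/IHg'.
  by apply: decomposed_eq; rewrite Comp_assoc.
- move=> B1 B1' B2 B2' g1 IH1 g2 IH2 /andP[/IH1{}IH1 /IH2{}IH2] A h.
  case=> A1 [A2 [s [h1 [h2 [hs /IH1 d1 /IH2 d2 e]]]]].
  exists A1, A2, s, (g1 ∘ h1)%arr, (g2 ∘ h2)%arr; split=> //.
  by rewrite e TenA_comp Comp_assoc.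
- move=> B C g _ _ A h [a ha e]; exists a => //.
  by rewrite -Comp_assoc delta_nat Comp_assoc e LA_comp Comp_assoc.
- move=> B1 B2 B3 _ A h.
  case=> A12 [A3 [s [h12 [h3 [hs]]]]].
  case=> [A1 [A2 [t [h1 [h2 [ht d1 d2 e]]]]]] d3 e'.
  exists A1, (A2 ⊗ A3)%ob, (assoc A1 A2 A3 ∘ (t ⊗ 𝟏 A3) ∘ s)%arr, h1,
    (h2 ⊗ h3)%arr; split=> //.
  + by rewrite /= hs ht.
  + by exists A2, A3, (𝟏 (A2 ⊗ A3))%arr, h2, h3; split=> //; rewrite Comp_idr.
  rewrite e' e -{1}(Comp_idr h3) TenA_comp -!Comp_assoc.
  by rewrite assoc_nat.
- move=> B1 B2 B3 _ A h.
  case=> A1 [A23 [s [h1 [h23 [hs d1]]]]].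
  case=> [A2 [A3 [t [h2 [h3 [ht d2 d3 e]]]]]] e'.
  exists (A1 ⊗ A2)%ob, A3, (assocV A1 A2 A3 ∘ (𝟏 A1 ⊗ t) ∘ s)%arr,
    (h1 ⊗ h2)%arr, h3; split=> //.
  + by rewrite /= hs ht.
  + by exists A1, A2, (𝟏 (A1 ⊗ A2))%arr, h1, h2; split=> //; rewrite Comp_idr.
  rewrite e' e -{1}(Comp_idr h1) TenA_comp -!Comp_assoc.
  by rewrite assocV_nat.
- move=> B _ A h [A1 [A2 [s [h1 [h2 [hs [t ht e1] d2 e]]]]]].
  apply: (decomposed_eq (h := (h2 ∘ (lunit A2 ∘ (t ⊗ 𝟏 A2) ∘ s))%arr)).
    rewrite e e1 -!Comp_assoc -lunit_nat.
    by rewrite (Comp_assoc (lunit B)) -TenA_comp Comp_idl Comp_idr.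
  by apply: decomposed_structural; rewrite //= ht hs.
- move=> B _ A h d; exists I, A, (lunitV A), (𝟏 I)%arr, h; split=> //.
    by exists (𝟏 I)%arr.
  by rewrite lunitV_nat.
- move=> B _ A h [A1 [A2 [s [h1 [h2 [hs d1 [t ht e2] e]]]]]].
  apply: (decomposed_eq (h := (h1 ∘ (runit A1 ∘ (𝟏 A1 ⊗ t) ∘ s))%arr)).
    rewrite e e2 -!Comp_assoc -runit_nat.
    by rewrite (Comp_assoc (runit B)) -TenA_comp Comp_idl Comp_idr.
  by apply: decomposed_structural; rewrite //= ht hs.
- move=> B _ A h d; exists A, I, (runitV A), h, (𝟏 I)%arr; split=> //.
    by exists (𝟏 I)%arr.
  by rewrite runitV_nat.
- move=> B _ A h [a ha e]; exists a => //.
  by rewrite LA_comp -Comp_assoc delta_delta !Comp_assoc e.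
- move=> B1 B2 _ A h [A1 [A2 [s [h1 [h2 [hs [a1 c1 e1] [a2 c2 e2] e]]]]]].
  have ca : coalgebra (psi A1 A2 ∘ (a1 ⊗ a2))%arr by exists a1, a2.
  have [a ha es] := coalgebra_structural hs ca; exists a => //.
  rewrite e !LA_comp -!Comp_assoc delta_psi !Comp_assoc -es.
  rewrite -(Comp_assoc (delta _ ⊗ _)%arr) -TenA_comp e1 e2 TenA_comp.
  by rewrite !Comp_assoc (comp_tail2 _ (psi_nat _ _)).
- move=> _ A h [s hs e].
  have c0 : coalgebra (@psi0 P) by [].
  have [a ha es] := coalgebra_structural hs c0; exists a => //.
  by rewrite e LA_comp -Comp_assoc delta_psi0 !Comp_assoc es.
Qed.

Lemma eps_free_decomposed P (A B : ob P) (h : arr A B) :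
  eps_free h -> decomposed h.
Proof.
move=> hh; apply: (decomposed_eq (Comp_idr h)).
exact: eps_free_decomposed_comp (decomposed_id A).
Qed.

(** A coalgebra morphism into a cofree coalgebra is determined by its composite
    with the counit. *)
Lemma eps_free_cofree P (A B : ob P) (h : arr A (L B)) : eps_free h ->
  exists2 a, coalgebra a & h ≈ LA (eps B ∘ h)%arr ∘ a.
Proof.
move=> /eps_free_decomposed[a ha e]; exists a => //.
by rewrite LA_comp Comp_assoc -e -Comp_assoc Leps_delta Comp_idl.
Qed.


(** * Factoring out the counits *)

(** One bit for each occurrence of [L], true if the occurrence is kept. *)
Fixpoint mask P (A : ob P) : Type :=
  match A with
  | Gen _ => unit
  | I => unit
  | Ten A B => (mask A * mask B)%type
  | L A => (bool * mask A)%type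
  end.

Fixpoint prune P (A : ob P) : mask A -> ob P :=
  match A with
  | Gen p => fun _ => Gen p
  | I => fun _ => I
  | Ten A B => fun m => (prune m.1 ⊗ prune m.2)%ob
  | L A => fun m => if m.1 then L (prune m.2) else prune m.2
  end.

Fixpoint erase P (A : ob P) : forall m : mask A, arr A (prune m) :=
  match A with
  | Gen p => fun _ => 𝟏 (Gen p)
  | I => fun _ => 𝟏 I
  | Ten A B => fun m => erase m.1 ⊗ erase m.2
  | L A => fun '(b, m) =>
      if b as b return arr (L A) (if b then L (prune m) else prune m)
      then LA (erase m) else erase m ∘ eps A
  end%arr.

(** Erasing twice amounts to erasing once, with a mask [k] for which [prune k]
    and [prune n] are equal but not convertible; an eps-free [h] stands for the
    transport between them. *)
Lemma erase_comp P (A : ob P) (m : mask A) (n : mask (prune m)) :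
  exists (k : mask A) (h : arr (prune k) (prune n)),
    eps_free h /\ erase n ∘ erase m ≈ h ∘ erase k.
Proof.
elim: A m n => [p||A IHA B IHB|A IHA] /=.
- by move=> [] []; exists tt, (𝟏 (Gen p))%arr.
- by move=> [] []; exists tt, (𝟏 I)%arr.
- move=> [m1 m2] /= [n1 n2].
  have [k1 [h1 [f1 e1]]] := IHA m1 n1; have [k2 [h2 [f2 e2]]] := IHB m2 n2.
  exists (k1, k2), (h1 ⊗ h2)%arr; rewrite /= f1 f2; split=> //.
  by rewrite -!TenA_comp e1 e2.
move=> [[] m] /=.
  move=> [b n]; have [k [h [f e]]] := IHA m n.
  case: b; [exists (true, k), (LA h)|exists (false, k), h]; split=> //=.
    by rewrite -!LA_comp e.
  by rewrite Comp_assoc eps_nat -!Comp_assoc e.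
move=> n; have [k [h [f e]]] := IHA m n.
by exists (false, k), h; rewrite /= -!Comp_assoc e.
Qed.

(** Counits move from the target of an eps-free arrow to its source.  Deleting
    one or both of the occurrences of [L] created by [delta], or the one
    created by [psi] or [psi0], cancels that arrow. *)
Lemma erase_commute P (A B : ob P) (h : arr A B) (m : mask B) : eps_free h ->
  exists (k : mask A) (h' : arr (prune k) (prune m)),
    eps_free h' /\ erase m ∘ h ≈ h' ∘ erase k.
Proof.
elim: A B / h m => //=.
- move=> A m _; exists m, (𝟏 (prune m))%arr.
  by rewrite Comp_idl Comp_idr.
- move=> A B C g IHg f IHf m /andP[/(IHg m)[n [g' [hg eg]]]].
  move=> /(IHf n)[k [f' [hf ef]]]; exists k, (g' ∘ f')%arr.
  by rewrite /= hg hf -Comp_assoc eg !Comp_assoc ef.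
- move=> A A' B B' f IHf g IHg [m1 m2] /andP[/(IHf m1)[k1 [f' [hf ef]]]].
  move=> /(IHg m2)[k2 [g' [hg eg]]]; exists (k1, k2), (f' ⊗ g')%arr.
  by rewrite /= hg hf -!TenA_comp ef eg.
- move=> A B f IHf [b m] /(IHf m)[k [f' [hf ef]]].
  case: b; [exists (true, k), (LA f')|exists (false, k), f']; split=> //=.
    by rewrite -!LA_comp ef.
  by rewrite Comp_assoc eps_nat -!Comp_assoc ef.
- move=> A B C [m1 [m2 m3]] _; exists ((m1, m2), m3), (assoc _ _ _).
  by rewrite assoc_nat.
- move=> A B C [[m1 m2] m3] _; exists (m1, (m2, m3)), (assocV _ _ _).
  by rewrite assocV_nat.
- by move=> A m _; exists (tt, m), (lunit _); rewrite lunit_nat.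
- by move=> A [[] m] _; exists m, (lunitV _); rewrite lunitV_nat.
- by move=> A m _; exists (m, tt), (runit _); rewrite runit_nat.
- by move=> A [m []] _; exists m, (runitV _); rewrite runitV_nat.
- move=> A [[] [[] m]] _ /=.
  + by exists (true, m), (delta _); rewrite delta_nat.
  + exists (true, m), (𝟏 (L (prune m)))%arr; split=> //.
    by rewrite LA_comp Comp_assoc Leps_delta Comp_idl Comp_idr.
  + exists (true, m), (𝟏 (L (prune m)))%arr; split=> //.
    by rewrite Comp_assoc eps_delta Comp_idl Comp_idr.
  + exists (false, m), (𝟏 (prune m))%arr; split=> //.
    by rewrite !Comp_assoc eps_delta Comp_idl Comp_idr.
- move=> A B [[] [m1 m2]] _ /=.
    by exists ((true, m1), (true, m2)), (psi _ _); rewrite /= psi_nat.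
  exists ((false, m1), (false, m2)), (𝟏 (prune m1 ⊗ prune m2))%arr.
  by rewrite /= Comp_assoc eps_psi -TenA_comp Comp_idl.
- move=> [[] []] _ /=.
    by exists tt, psi0; rewrite LA_id Comp_idl Comp_idr.
  by exists tt, (𝟏 I)%arr; rewrite Comp_assoc eps_psi0.
Qed.

Lemma erase_nothing P (A : ob P) : exists (m : mask A) (h : arr (prune m) A),
  eps_free h /\ 𝟏 A ≈ h ∘ erase m.
Proof.
elim: A => [p||A [m [h [hh e]]] B [n [k [hk e']]]|A [m [h [hh e]]]].
- by exists tt, (𝟏 (Gen p))%arr; rewrite Comp_idl.
- by exists tt, (𝟏 I)%arr; rewrite Comp_idl.
- by exists (m, n), (h ⊗ k)%arr; rewrite /= hh hk -TenA_comp -e -e' TenA_id.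
- by exists (true, m), (LA h); rewrite /= hh -LA_comp -e LA_id.
Qed.

Lemma eps_factorization P (A B : ob P) (f : arr A B) :
  exists (m : mask A) (h : arr (prune m) B), eps_free h /\ f ≈ h ∘ erase m.
Proof.
have atomic (C D : ob P) (g : arr C D) : eps_free g ->
    exists (m : mask C) (h : arr (prune m) D),
      eps_free h /\ g ≈ h ∘ erase m.
  move=> hg; have [m [h [hh e]]] := erase_nothing C.
  by exists m, (g ∘ h)%arr; rewrite /= hg hh Comp_assoc -e Comp_idr.
elim: A B / f; try by move=> *; apply: atomic.
- move=> A B C g [n [k [hk eg]]] f [m [h [hh ef]]].
  have [m' [h' [hh' e']]] := erase_commute n hh.
  have [m'' [h'' [hh'' e'']]] := erase_comp m'.
  exists m'', (k ∘ (h' ∘ h''))%arr; rewrite /= hk hh' hh''; split=> //.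
  by rewrite eg ef !Comp_assoc -e'' (comp_tail2 _ e').
- move=> A A' B B' f [m [h [hh ef]]] g [n [k [hk eg]]].
  by exists (m, n), (h ⊗ k)%arr; rewrite /= hh hk -TenA_comp -ef -eg.
- move=> A B f [m [h [hh ef]]].
  by exists (true, m), (LA h); rewrite /= hh -LA_comp -ef.
- move=> A; have [m [h [hh e]]] := erase_nothing A.
  by exists (false, m), h; rewrite /= -Comp_assoc -e Comp_idl.
Qed.

(** * The relation determines the erased occurrences *)

(** The bit of the occurrence of [L] numbered [x], counted from right to
    left. *)
Fixpoint kept P (A : ob P) : mask A -> nat -> bool :=
  match A with
  | Gen _ => fun _ _ => false
  | I => fun _ _ => false
  | Ten A B => fun m x =>
      if x < Gob B then kept m.2 x else kept m.1 (x - Gob B)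
  | L A => fun m x => if x == Gob A then m.1 else kept m.2 x
  end.

Lemma kept_inj P (A : ob P) (m n : mask A) :
  (forall x, x < Gob A -> kept m x = kept n x) -> m = n.
Proof.
elim: A m n => [p||A IHA B IHB|A IHA].
- by move=> [] [].
- by move=> [] [].
- move=> [m1 m2] [n1 n2] /= e; congr pair.
    apply: IHA => x hx; have := e (x + Gob B).
    rewrite addnK; case: (ltnP (x + Gob B) (Gob B)) => [|_ ->] //; lia.
  by apply: IHB => x hx; have := e x; rewrite hx => -> //; lia.
- move=> [b m] [c n] /= e; congr pair.
    by have := e (Gob A); rewrite eqxx => ->.
  by apply: IHA => x hx; have := e x; rewrite ltn_eqF // => -> //; lia.
Qed.

(** The domain recovers the mask; being single-valued and surjective makes the
    relation of [erase m] right-cancellable. *)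
Lemma erase_rel P (A : ob P) (m : mask A) :
  [/\ forall x, x < Gob A ->
        ((exists y, nrel (Garr (erase m)) x y) <-> kept m x),
      forall x y y', nrel (Garr (erase m)) x y ->
        nrel (Garr (erase m)) x y' -> y = y'
    & forall y, y < Gob (prune m) -> exists x, nrel (Garr (erase m)) x y].
Proof.
elim: A m => [p||A IHA B IHB|A IHA] /=.
- by move=> _; split=> [x|x y y'|y]; rewrite ?ltn0 // !nrel_eq; lia.
- by move=> _; split=> [x|x y y'|y]; rewrite ?ltn0 // !nrel_eq; lia.
- move=> [m1 m2] /=; have [d1 f1 s1] := IHA m1; have [d2 f2 s2] := IHB m2.
  split.
  + move=> x hx; case: ltnP => h.
      rewrite -(d2 _ h); split=> -[y hy]; exists y.
        by move/nrel_juxt: hy => [] //; lia.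
      by apply/nrel_juxt; left.
    rewrite -d1; last lia; split=> -[y hy].
      move/nrel_juxt: hy => [hy|[_ [_ hy]]]; last by eexists; exact: hy.
      by have [] := nrel_bound hy; lia.
    exists (Gob (prune m2) + y); apply/nrel_juxt; right.
    by rewrite addKn; split=> //; split=> //; lia.
  + move=> x y y' /nrel_juxt[h|[l [l' h]]] /nrel_juxt[k|[r [r' k]]].
    * exact: f2 h k.
    * by have [] := nrel_bound h; lia.
    * by have [] := nrel_bound k; lia.
    * by have := f1 _ _ _ h k; lia.
  + move=> y hy; case: (ltnP y (Gob (prune m2))) => h.
      by have [x hx] := s2 _ h; exists x; apply/nrel_juxt; left.
    have /s1[x hx] : y - Gob (prune m2) < Gob (prune m1) by lia.
    exists (Gob B + x); apply/nrel_juxt; right.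
    by rewrite addKn leq_addr.
move=> [b m]; have [d f s] := IHA m; case: b => /=.
  split.
  + move=> x hx; case: eqP => [->|h].
      split=> // _; exists (Gob (prune m)); apply/nrel_lift; by left.
    rewrite -d; last lia; split=> -[y hy]; exists y.
      by move/nrel_lift: hy => [] //; lia.
    by apply/nrel_lift; right.
  + move=> x y y' /nrel_lift[h|h] /nrel_lift[k|k].
    * by lia.
    * by have [] := nrel_bound k; lia.
    * by have [] := nrel_bound h; lia.
    * exact: f h k.
  + move=> y hy; case: (eqVneq y (Gob (prune m))) => h.
      by exists (Gob A); apply/nrel_lift; left.
    have /s[x hx] : y < Gob (prune m) by lia.
    by exists x; apply/nrel_lift; right.
have E x y : nrel (rel_comp (Garr (erase m)) (rel_eq (Gob A).+1 (Gob A))) x y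
    <-> nrel (Garr (erase m)) x y.
  rewrite nrel_comp; split=> [[z [/nrel_eq[_ [_ ->]]]]|h] //.
  by have [hx _] := nrel_bound h; exists x; split=> //; apply/nrel_eq; lia.
split.
- move=> x hx; case: eqP => [->|h].
    by split=> // -[y /E hy]; have [] := nrel_bound hy; lia.
  by rewrite -d; last lia; split=> -[y hy]; exists y; apply/E.
- by move=> x y y' /E h /E; exact: f.
- by move=> y /s[x hx]; exists x; apply/E.
Qed.

(** Only [eps] leaves an occurrence of [L] in its source unrelated. *)
Lemma eps_free_total P (A B : ob P) (h : arr A B) : eps_free h ->
  forall x, x < Gob A -> exists y, nrel (Garr h) x y.
Proof.
have total_eq n m x : n = m -> x < n -> exists y, nrel (rel_eq n m) x y.
  by move=> -> hx; exists x; apply/nrel_eq.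
elim: A B / h => //=; try by move=> *; apply: total_eq => //; lia.
- move=> A B C g IHg f IHf /andP[/IHg{}IHg /IHf{}IHf] x /IHf[y hy].
  have [_ /IHg[z hz]] := nrel_bound hy.
  by exists z; apply/nrel_comp; exists y.
- move=> A A' B B' f IHf g IHg /andP[/IHf{}IHf /IHg{}IHg] x hx.
  case: (ltnP x (Gob B)) => [/IHg[y hy]|h].
    by exists y; apply/nrel_juxt; left.
  have /IHf[y hy] : x - Gob B < Gob A by lia.
  exists (Gob B' + y); apply/nrel_juxt; right.
  by rewrite addKn; split=> //; split=> //; lia.
- move=> A B f IHf /IHf{}IHf x hx; case: (eqVneq x (Gob A)) => [->|h].
    by exists (Gob B); apply/nrel_lift; left.
  have /IHf[y hy] : x < Gob A by lia.
  by exists y; apply/nrel_lift; right.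
- by move=> A _ x hx; exists x; apply/nrel_of; lia.
- move=> A B _ x hx; case: (ltnP x (Gob B)) => h.
    by exists x; apply/nrel_of; rewrite /psi_rel; lia.
  case: (boolP ((x == Gob B) || (x == (Gob B).+1 + Gob A))) => h'.
    by exists (Gob B + Gob A); apply/nrel_of; rewrite /psi_rel; lia.
  by exists x.-1; apply/nrel_of; rewrite /psi_rel; lia.
Qed.

(** The mask is read off from the domain of the relation, and [erase m], whose
    relation is a surjective partial function, can be cancelled on the
    right. *)
Lemma faithful_reduction P (B : ob P) :
  (forall (A : ob P) (h k : arr A B), eps_free h -> eps_free k ->
     Garr h = Garr k -> h ≈ k) ->
  forall (A : ob P) (f g : arr A B), Garr f = Garr g -> f ≈ g.
Proof.
move=> H A f g e.
have [m [h [hh ef]]] := eps_factorization f.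
have [n [k [hk eg]]] := eps_factorization g.
have dom (l : mask A) (j : arr (prune l) B) (r : arr A B) x : eps_free j ->
    r ≈ j ∘ erase l -> x < Gob A ->
    ((exists y, nrel (Garr r) x y) <-> kept l x).
  move=> hj /Garr_sound -> hx; have [d _ _] := erase_rel l.
  rewrite -d //=; split=> -[y].
    by move/nrel_comp=> [z [hz _]]; exists z.
  move=> hy; have [_ /(eps_free_total hj)[z hz]] := nrel_bound hy.
  by exists z; apply/nrel_comp; exists y.
have emn : m = n.
  apply: kept_inj => x hx; apply/idP/idP.
    by move=> /(dom _ _ _ _ hh ef hx); rewrite e => /(dom _ _ _ _ hk eg hx).
  by move=> /(dom _ _ _ _ hk eg hx); rewrite -e => /(dom _ _ _ _ hh ef hx).
subst n; rewrite ef eg (H _ h k hh hk) //.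
move: e; rewrite (Garr_sound ef) (Garr_sound eg) /= => e.
have [_ fun_e surj_e] := erase_rel m.
have sub (R S : relation (Gob (prune m)) (Gob B)) :
    rel_comp R (Garr (erase m)) = rel_comp S (Garr (erase m)) ->
    forall y z, nrel R y z -> nrel S y z.
  move=> eRS y z hyz; have [/surj_e[x hx] _] := nrel_bound hyz.
  have : nrel (rel_comp R (Garr (erase m))) x z.
    by apply/nrel_comp; exists y.
  by rewrite eRS => /nrel_comp[y' [hy']]; rewrite (fun_e _ _ _ hx hy').
by apply: nrelP => y z; split; apply: sub.
Qed.


(** * Splitting a source along a tensor product *)

Fixpoint generators P (A : ob P) : nat :=
  match A with
  | Gen _ => 1
  | I => 0
  | Ten A B => generators A + generators B
  | L A => generators A
  end.

Lemma generators_arr P (A B : ob P) (f : arr A B) :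
  generators A = generators B.
Proof. by elim: A B / f => //=; lia. Qed.

(** Positive on atoms, which makes the weight of a prefix of a list of atoms
    determine the prefix. *)
Definition weight P (A : ob P) : nat := generators A + Gob A.

Lemma flatten_onto_cat P (A : ob P) l :
  flatten_onto A l = flatten_onto A [::] ++ l.
Proof.
elim: A l => //= A IHA B IHB l.
by rewrite IHA IHB (IHA (flatten_onto B _)) catA.
Qed.

Lemma weight_flatten P (A : ob P) l :
  sumn (map (@weight P) (flatten_onto A l))
  = weight A + sumn (map (@weight P) l).
Proof.
elim: A l => //= A IHA B IHB l.
by rewrite IHA IHB /weight /=; lia.
Qed.

Lemma weight_flatten_gt0 P (A : ob P) l :
  all (fun X => 0 < weight X) l ->
  all (fun X => 0 < weight X) (flatten_onto A l).
Proof.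
elim: A l => //= [A IHA B IHB l hl|A _ l ->].
  exact/IHA/IHB.
by rewrite /weight /= addnS.
Qed.

Lemma cat_eq_weight (T : Type) (w : T -> nat) (l1 l2 l1' l2' : seq T) :
  all (fun x => 0 < w x) l1 -> all (fun x => 0 < w x) l1' ->
  sumn (map w l1) = sumn (map w l1') -> l1 ++ l2 = l1' ++ l2' ->
  l1 = l1' /\ l2 = l2'.
Proof.
elim: l1 l1' => [|x l1 IH] [|x' l1'] //=.
- by move=> _ /andP[h _] /= e; lia.
- by move=> /andP[h _] _ e; lia.
move=> /andP[h p] /andP[h' p'] e [ex el]; subst x'.
by have [||||-> ->] := IH l1' => //; lia.
Qed.

(** Both [A1] and [A1'] flatten to prefixes of the list of atoms of [A]; having
    the same weight, these prefixes coincide. *)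
Lemma structural_split P (A A1 A2 A1' A2' : ob P) (s : arr A (A1 ⊗ A2))
    (t : arr A (A1' ⊗ A2')) :
  structural s -> structural t -> weight A1 = weight A1' ->
  exists (u : arr A1 A1') (v : arr A2 A2'), t ≈ (u ⊗ v) ∘ s.
Proof.
move=> hs ht ew.
have [qs _] := norm_structural hs [::]; have [qt _] := norm_structural ht [::].
have [||||/structural_exists[u hu] /structural_exists[v hv]] :=
  @cat_eq_weight _ (@weight P) (flatten_onto A1 [::]) (flatten_onto A2 [::])
    (flatten_onto A1' [::]) (flatten_onto A2' [::]).
- exact: weight_flatten_gt0.
- exact: weight_flatten_gt0.
- by rewrite !weight_flatten ew.
- by rewrite -!flatten_onto_cat; move: qt; rewrite qs.
by exists u, v; apply: structural_coherence => //=; rewrite hu hv.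
Qed.

Lemma rel_juxt_inj n m n' m' (R R' : relation n m) (S S' : relation n' m') :
  (forall x y, nrel (rel_juxt R S) x y <-> nrel (rel_juxt R' S') x y) ->
  R = R' /\ S = S'.
Proof.
move=> e.
have sub (Q Q' : relation n m) (T T' : relation n' m') :
    (forall x y, nrel (rel_juxt Q T) x y -> nrel (rel_juxt Q' T') x y) ->
    (forall x y, nrel Q x y -> nrel Q' x y) /\
    (forall x y, nrel T x y -> nrel T' x y).
  move=> H; split=> x y h.
    have /nrel_juxt[k|] : nrel (rel_juxt Q' T') (n' + x) (m' + y).
    - by apply/H/nrel_juxt; right; rewrite !addKn !leq_addr.
    - by have [] := nrel_bound k; lia.
    by rewrite !addKn => -[_ []].
  have [bx by_] := nrel_bound h.
  have /nrel_juxt[//|[l _]] : nrel (rel_juxt Q' T') x y.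
    by apply/H/nrel_juxt; left.
  by lia.
have [h1 h2] := sub _ _ _ _ (fun x y => (e x y).1).
have [k1 k2] := sub _ _ _ _ (fun x y => (e x y).2).
by split; apply: nrelP => x y; split; auto.
Qed.

Lemma Garr_tensor_structural P (A A1 A2 B1 B2 : ob P) (h : arr A (B1 ⊗ B2))
    (s : arr A (A1 ⊗ A2)) (h1 : arr A1 B1) (h2 : arr A2 B2) :
  structural s -> h ≈ (h1 ⊗ h2) ∘ s ->
  forall x y, nrel (Garr h) x y <-> nrel (rel_juxt (Garr h1) (Garr h2)) x y.
Proof.
move=> /Garr_structural[/= eA es] /Garr_sound -> x y /=.
by rewrite es; apply: nrel_comp_eqr.
Qed.

(** If [A2] had fewer occurrences of [L] than [A2'], the rightmost occurrence
    in [A1], which exists and is numbered [Gob A2], would be related to an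
    occurrence in [B1] by [h], and only to occurrences in [B2] by [k]. *)
Lemma tensor_split_size P (A A1 A2 A1' A2' B1 B2 : ob P)
    (h k : arr A (B1 ⊗ B2)) (s : arr A (A1 ⊗ A2)) (t : arr A (A1' ⊗ A2'))
    (h1 : arr A1 B1) (h2 : arr A2 B2) (k1 : arr A1' B1) (k2 : arr A2' B2) :
  structural s -> h ≈ (h1 ⊗ h2) ∘ s -> eps_free h ->
  structural t -> k ≈ (k1 ⊗ k2) ∘ t -> Garr h = Garr k ->
  Gob A2' <= Gob A2.
Proof.
move=> hs eh fh ht ek e; rewrite leqNgt; apply/negP => lt.
have [/= eA _] := Garr_structural hs; have [/= eA' _] := Garr_structural ht.
have [|y hy] := eps_free_total fh (x := Gob A2); first lia.
have := hy; rewrite (Garr_tensor_structural hs eh) => /nrel_juxt[b|[_ [le _]]].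
  by have [] := nrel_bound b; lia.
move: hy; rewrite e (Garr_tensor_structural ht ek) => /nrel_juxt[b|[]].
  by have [] := nrel_bound b; lia.
by lia.
Qed.

(** * Faithfulness *)

(** The induction hypothesis is needed for all arrows into the smaller target,
    as [eps B ∘ h] is no longer eps-free. *)
Lemma Garr_inj P (B A : ob P) (f g : arr A B) : Garr f = Garr g -> f ≈ g.
Proof.
elim: B A f g => [p||B1 IH1 B2 IH2|B IH]; apply: faithful_reduction => A h k.
- move=> /eps_free_decomposed[s hs eh] /eps_free_decomposed[t ht ek] _.
  by rewrite eh ek; apply: structural_coherence.
- move=> /eps_free_decomposed[s hs eh] /eps_free_decomposed[t ht ek] _.
  by rewrite eh ek; apply: structural_coherence.
- move=> fh fk e.
  have [A1 [A2 [s [h1 [h2 [hs _ _ eh]]]]]] := eps_free_decomposed fh.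
  have [A1' [A2' [t [k1 [k2 [ht _ _ ek]]]]]] := eps_free_decomposed fk.
  have le := tensor_split_size hs eh fh ht ek e.
  have ge := tensor_split_size ht ek fk hs eh (esym e).
  have [/= eA _] := Garr_structural hs; have [/= eA' _] := Garr_structural ht.
  have [|u [v et]] := structural_split hs ht.
    by rewrite /weight (generators_arr h1) (generators_arr k1); lia.
  have {}ek : k ≈ ((k1 ∘ u) ⊗ (k2 ∘ v)) ∘ s.
    by rewrite ek et TenA_comp Comp_assoc.
  have [e1 e2] : Garr h1 = Garr (k1 ∘ u)%arr /\ Garr h2 = Garr (k2 ∘ v)%arr.
    apply: rel_juxt_inj => x y.
    by rewrite -(Garr_tensor_structural hs eh) e (Garr_tensor_structural hs ek).
  by rewrite eh ek (IH1 _ _ _ e1) (IH2 _ _ _ e2).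
- move=> /eps_free_cofree[a ha eh] /eps_free_cofree[b hb ek] e.
  rewrite eh ek (coalgebra_unique ha hb).
  rewrite (IH _ (eps B ∘ h)%arr (eps B ∘ k)%arr) //.
  by rewrite /= e.
Qed.

Theorem mainTheorem8 (P : Type) : faithful (G P).
Proof.
move=> A B f g.
exact: Garr_inj.
Qed.
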